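(* For all integers $m,n\ge 2$, every 3-dependent set in $T[m,n]$ has at most $mn/2$ vertices. Moreover, $\tau_3^{(2)} = 1/2$.
   Context: For integers $m,n\ge 2$, the toroidal kings graph $T[m,n]$ has vertex set $\{1,\ldots,m\}\times\{1,\ldots,n\}$, with the first coordinate read modulo $m$ and the second modulo $n$; distinct vertices $v,u$ are neighbors if and only if $v_1-u_1\equiv -1,0$ or $1\pmod m$ and $v_2-u_2\equiv -1,0$ or $1\pmod n$. When $m$ or $n$ equals $2$, neighbors are counted with multiplicity: the number of neighbors of $v$ in a vertex set $S$ is the number of nonzero $y\in\{-1,0,1\}^2$ with $v+y\in S$ (this agrees with the ordinary count when $m,n\ge 3$). A set $S$ of vertices is $k$-dependent if each vertex of $S$ has at most $k$ neighbors in $S$. Let $\beta_k(T[n,n])$ be the maximum cardinality of a $k$-dependent set in $T[n,n]$, and let $\tau^{(2)}_k=\lim_{n\to\infty}\beta_k(T[n,n])/n^2$ (this limit exists). *)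

(* Defs.v *)
From HB Require Import structures.
From mathcomp Require Import all_boot all_order all_algebra.
From mathcomp Require Import all_classical all_reals all_analysis.
Set Implicit Arguments.
Unset Strict Implicit.
Unset Printing Implicit Defensive.
Import Order.TTheory GRing.Theory Num.Theory.
Import numFieldNormedType.Exports.
Local Open Scope ring_scope.

(* 'Z_m is Z/mZ only for m >= 2 ('Z_0 and 'Z_1 are Z/2Z), which is the range
   in which T[m, n] is defined. *)
Notation torus m n := ('Z_m * 'Z_n)%type.

(* Integer vectors rather than residues: modulo 2 the steps -1 and 1 coincide
   but must be counted separately. *)
Definition king_steps : seq (int * int) :=
  [seq y <- [seq (a, b) | a <- [:: -1; 0; 1], b <- [:: -1; 0; 1]]
     | y != (0, 0)].

Definition king_move (m n : nat) (v : torus m n) (y : int * int) : torus m n :=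
  (v.1 + y.1%:~R, v.2 + y.2%:~R).

Definition nb_neighbors (m n : nat) (S : {set torus m n}) (v : torus m n) :
    nat :=
  count (fun y => king_move v y \in S) king_steps.

Definition kdependent (k m n : nat) (S : {set torus m n}) : bool :=
  [forall v in S, (nb_neighbors S v <= k)%N].

Definition beta (k m n : nat) : nat :=
  \max_(S : {set torus m n} | kdependent k S) #|S|.

(* The terms n = 0, 1 are meaningless but do not affect the limit. *)
Definition beta_density (R : realType) (k n : nat) : R :=
  (beta k n n)%:R / n%:R ^+ 2.

Definition tau2 (R : realType) (k : nat) : R := limn (beta_density R k).

Definition king_adj (m n : nat) (v u : torus m n) : bool :=
  [&& v != u, v.1 - u.1 \in [:: -1; 0; 1] & v.2 - u.2 \in [:: -1; 0; 1]].

Lemma Zp_intr_inj3 (m : nat) : (2 < m)%N ->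
  {in [:: -1; 0; 1] &, injective (fun a : int => a%:~R : 'Z_m)}.
Proof.
case: m => [|[|[|m]]] // _ a b; rewrite !inE.
by case/or3P=> /eqP -> /or3P[] /eqP -> //= /(congr1 val) /=;
  rewrite ?modn_small.
Qed.

(* For m, n >= 3 this is the usual count of neighbors in the simple graph. *)
Lemma nb_neighborsE (m n : nat) (S : {set torus m n}) (v : torus m n) :
  (2 < m)%N -> (2 < n)%N ->
  nb_neighbors S v = #|[set u in S | king_adj v u]|.
Proof.
move=> m3 n3; have [injm injn] := (Zp_intr_inj3 m3, Zp_intr_inj3 n3).
have stepP a b : ((a, b) \in king_steps) =
    [&& (a, b) != (0, 0), a \in [:: -1; 0; 1] & b \in [:: -1; 0; 1]].
  rewrite mem_filter; congr (_ && _); apply/idP/idP.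
    by move=> /allpairsP[[a' b'] [/= ain bin [-> ->]]]; apply/andP.
  by case/andP=> ain bin; apply/allpairsP; exists (a, b).
have in0 : 0 \in [:: -1; 0; 1 : int] by [].
have inN (a : int) : (- a \in [:: -1; 0; 1]) = (a \in [:: -1; 0; 1]).
  by rewrite !inE oppr_eq0 !eqr_oppLR opprK; do 3 case: (_ == _).
rewrite /nb_neighbors -size_filter -(size_map (king_move v)).
rewrite -(card_uniqP _); last first.
  rewrite map_inj_in_uniq ?filter_uniq // => -[a b] [c d].
  rewrite mem_filter stepP => /and4P[_ _ ain bin].
  rewrite mem_filter stepP => /and4P[_ _ cin din].
  move=> vac; have /addrI/(injm a c ain cin) -> := congr1 fst vac.
  by have /addrI/(injn b d bin din) -> := congr1 snd vac.
have stepZ p (x : 'Z_p) :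
    x \in [:: -1; 0; 1] -> exists2 a : int, a \in [:: -1; 0; 1] & a%:~R = x.
  by rewrite !inE => /or3P[] /eqP ->; [exists (-1)|exists 0|exists 1].
have Zstep p (a : int) : a \in [:: -1; 0; 1] ->
    (a%:~R : 'Z_p) \in [:: -1; 0; 1].
  by rewrite !inE => /or3P[] /eqP ->; rewrite ?mulrNz ?eqxx ?orbT.
apply: eq_card => u; rewrite inE; apply/mapP/andP.
  case=> -[a b]; rewrite mem_filter stepP => /and4P[uS ab0 ain bin] ->.
  split=> //; apply/and3P; split=> /=.
  - apply: contra ab0 => /eqP vab.
    have := congr1 fst vab; rewrite -[LHS]addr0 => /addrI/esym.
    move=> /(injm a 0 ain in0) ->.
    have := congr1 snd vab; rewrite -[LHS]addr0 => /addrI/esym.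
    by move=> /(injn b 0 bin in0) ->.
  - by rewrite opprD addNKr -mulrNz Zstep // inN.
  - by rewrite opprD addNKr -mulrNz Zstep // inN.
case=> uS /and3P[vu /stepZ[a ain aE] /stepZ[b bin bE]].
have uE : u = king_move v (- a, - b).
  by rewrite /king_move /= !mulrNz aE bE !opprB !subrKC; case: (u).
exists (- a, - b) => //; rewrite mem_filter -uE uS stepP !inN ain bin !andbT /=.
apply: contra vu => /eqP ab0.
by rewrite uE ab0 /king_move /= !addr0; case: (v).
Qed.

(* Main.v *)
Require Import Defs.
From HB Require Import structures.
From mathcomp Require Import all_boot all_order all_algebra.
From mathcomp Require Import all_classical all_reals all_analysis.
From mathcomp Require Import zify ring lra.
Set Implicit Arguments.
Unset Strict Implicit.
Unset Printing Implicit Defensive.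
Import Order.TTheory GRing.Theory Num.Theory.
Import numFieldNormedType.Exports.
Local Open Scope ring_scope.

(** Upper bound.  Let [S] be 3-dependent.  Read [S] through each of the 4 x 4
windows of the torus, one window per vertex; let [C] and [E] count the vertices
of [S] among the 4 central cells of the window and among the 8 cells that share
an edge with a central cell.  By translation invariance the average of
[2 * C + E] over all windows is 16 times the density of [S], so the bound 1/2
would follow from [2 * C + E <= 8].  Parallel full lines at distance 2, which
have density 1/2, give exactly 8 in every window, but some windows give 9 or 10,
for instance (# marks a vertex of [S])
<<
            . . . .
            . # # #
            # . . #
            . # # .
>>
which gives 9.  The remedy is to add a correction that averages to zero.  A vee
is a cell together with the two cells diagonally adjacent to it in a common
direction, like the two arms of the letter V.  The number [V] of vees contained
in [S] that lie in the window with their apex in the centre, opening outward,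
and the number [V'] of those with their apex next to the centre, opening inward
and covering a central cell, have the same average, because each of the eight
inward places is a translate of an outward one by two steps.  The local
inequality
<<
            2 * C + E + V <= 8 + V'
>>
holds in every window whose central vertices have at most 3 neighbors in [S]
([window_ineq]).  In the picture it is saved by the two inward vees with apex
at the ends of the third row.  It speaks of 16 bits, hence is a finite check.
Summing it over the torus cancels the vees and leaves [16 * #|S| <= 8 * m * n]
([kdependent3_card]).  Windows are indexed by integer offsets, and so are the
neighbors, so the argument covers small tori, where a window overlaps itself
and neighbors are counted with multiplicity.

Lower bound.  The rows of odd index form a 3-dependent set of [n./2 * n]
vertices ([odd_rows_dependent], [card_odd_rows]), so the density tends to 1/2 by
squeezing. *)

(** * The inequality on a 4 x 4 window *)

(** Cells of a window have coordinates between -1 and 2, so that the 4 central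
cells are those with coordinates 0 and 1. *)
Definition center : seq (int * int) := [:: (0, 0); (0, 1); (1, 0); (1, 1)].

Definition sides : seq (int * int) :=
  [:: (-1, 0); (-1, 1); (2, 0); (2, 1); (0, -1); (1, -1); (0, 2); (1, 2)].

(** The vee with apex [c] opening in the direction of the unit vector [d]; up to
sign, [(d.2, d.1)] is the perpendicular of [d]. *)
Definition vee (c d : int * int) : seq (int * int) :=
  [:: c; c + d + (d.2, d.1); c + d - (d.2, d.1)].

(** The pairs of a central cell and of a direction pointing out of the centre
from it. *)
Definition outward : seq ((int * int) * (int * int)) :=
  [:: ((0, 0), (-1, 0)); ((0, 1), (-1, 0)); ((1, 0), (1, 0)); ((1, 1), (1, 0));
      ((0, 0), (0, -1)); ((1, 0), (0, -1)); ((0, 1), (0, 1)); ((1, 1), (0, 1))].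

Definition outward_vees := [seq vee p.1 p.2 | p <- outward].

(** Two steps against [d] take a central cell on the border facing [d] to the
side cell on the opposite border, from where [d] points into the centre. *)
Definition inward_vees := [seq vee (p.1 - p.2 *+ 2) p.2 | p <- outward].

Definition center_neighborhoods : seq ((int * int) * seq (int * int)) :=
  [seq (c, [seq c + y | y <- king_steps]) | c <- center].

(** Only central cells have all their neighbors inside the window. *)
Definition center_dependent (w : pred (int * int)) : bool :=
  all (fun cN => w cN.1 ==> (count w cN.2 <= 3)%N) center_neighborhoods.

Definition window_bound (w : pred (int * int)) : bool :=
  (2 * count w center + count w sides + count (all w) outward_vees
     <= 8 + count (all w) inward_vees)%N.

(** Quantification over bit sequences of length [n] as a bare recursion, which
evaluation can decide; enumerations of finite types are locked. *)
Fixpoint all_bits (n : nat) (P : seq bool -> bool) : bool :=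
  if n is n'.+1 then
    all_bits n' (fun s => P (true :: s)) && all_bits n' (fun s => P (false :: s))
  else P [::].

Lemma all_bitsP n P (s : seq bool) : all_bits n P -> size s = n -> P s.
Proof.
elim: n P s => [|n IHn] P [|b s] //= /andP[Pt Pf] [sn].
by case: b; [apply: (IHn (fun s => P (true :: s)))
            |apply: (IHn (fun s => P (false :: s)))].
Qed.

(** The window whose cells, row by row, are the bits of [s]. *)
Definition pattern (s : seq bool) (c : int * int) : bool :=
  nth false s (4 * absz (c.1 + 1) + absz (c.2 + 1)).

Definition window : seq (int * int) :=
  [seq (a, b) | a <- [:: -1; 0; 1; 2], b <- [:: -1; 0; 1; 2]].

Lemma window_check :
  all_bits 16 (fun s => center_dependent (pattern s) ==> window_bound (pattern s)).
Proof. by vm_compute. Qed.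

(** The vees are what makes this true: the left side without [outward_vees]
reaches 10, and every excess over 8 comes with inward vees; the outward vees
are the price for these to cancel on average. *)
Lemma window_ineq (w : pred (int * int)) : center_dependent w -> window_bound w.
Proof.
(* Once its coordinates are evaluated, the pattern of these 16 bits is w itself. *)
have /implyP := all_bitsP window_check (erefl : size (map w window) = 16).
exact.
Qed.

(** * Averaging over the torus *)

Lemma king_moveD (m n : nat) (v : torus m n) (c d : int * int) :
  king_move v (c + d) = king_move (king_move v c) d.
Proof. by rewrite /king_move /= !intrD !addrA. Qed.

Lemma king_move_bij (m n : nat) (c : int * int) :
  bijective (fun v : torus m n => king_move v c).
Proof.
have king_moveK (d : int * int) (v : torus m n) :
    king_move (king_move v d) (- d) = v.
  by rewrite -king_moveD subrr /king_move !addr0; case: v.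
exists (fun v => king_move v (- c)) => v; first exact: king_moveK.
by rewrite -[X in king_move _ X]opprK king_moveK.
Qed.

(** The number of translates of [A] inside [S], indexed by the translation
vector; on a small torus different cells of [A] may fall on the same vertex. *)
Definition occurrences (m n : nat) (S : {set torus m n})
    (A : seq (int * int)) : nat :=
  (\sum_v all (fun c => king_move v c \in S) A)%N.

Lemma occurrences_shift (m n : nat) (S : {set torus m n}) A (t : int * int) :
  occurrences S [seq t + c | c <- A] = occurrences S A.
Proof.
rewrite /occurrences [RHS](reindex (fun v => king_move v t)) /=; last first.
  exact/onW_bij/king_move_bij.
apply: eq_bigr => v _; rewrite all_map; congr (nat_of_bool _).
by apply: eq_all => c /=; rewrite king_moveD.
Qed.

Lemma occurrences1 (m n : nat) (S : {set torus m n}) (c : int * int) :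
  occurrences S [:: c] = #|S|.
Proof.
have -> : [:: c] = [seq c + y | y <- [:: 0]] by rewrite /= addr0.
rewrite occurrences_shift /occurrences.
rewrite -sum1_card [RHS]big_mkcond /=; apply: eq_bigr => v _.
by rewrite /king_move /= !addr0 andbT; case: v => a b /=; case: ifP.
Qed.

Lemma sum_count_all (m n : nat) (S : {set torus m n}) L :
  (\sum_v count (all (fun c => king_move v c \in S)) L
   = \sum_(A <- L) occurrences S A)%N.
Proof.
rewrite exchange_big /=; apply: eq_bigr => v _.
by elim: L => [|A L IHL] /=; rewrite ?big_nil // big_cons IHL.
Qed.

Lemma sum_count (m n : nat) (S : {set torus m n}) L :
  (\sum_v count (fun c => king_move v c \in S) L = size L * #|S|)%N.
Proof.
have countE v : count (fun c => king_move v c \in S) L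
    = count (all (fun c => king_move v c \in S)) [seq [:: c] | c <- L].
  by rewrite count_map; apply: eq_count => c /=; rewrite andbT.
rewrite (eq_bigr _ (fun v _ => countE v)) sum_count_all big_map.
rewrite (eq_bigr _ (fun c _ => occurrences1 S c)).
by rewrite big_const_seq count_predT iter_addn_0 mulnC.
Qed.

Lemma inward_outward_vees (m n : nat) (S : {set torus m n}) :
  (\sum_(A <- inward_vees) occurrences S A
   = \sum_(A <- outward_vees) occurrences S A)%N.
Proof.
rewrite !big_map; apply: eq_bigr => -[c d] _ /=.
rewrite -[RHS](occurrences_shift _ _ (- (d *+ 2))); congr (occurrences S _).
by rewrite /vee /= !addrA [in RHS](addrC _ c).
Qed.

Lemma kdependent_center (m n : nat) (S : {set torus m n}) (v : torus m n) :
  kdependent 3 S -> center_dependent (fun c => king_move v c \in S).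
Proof.
move=> /forall_inP Sdep; apply/allP => _ /mapP[c _ ->].
apply/implyP => /Sdep; rewrite /nb_neighbors => le3.
rewrite count_map (eq_count (a2 := fun y => king_move (king_move v c) y \in S)) //.
by move=> y; rewrite -king_moveD.
Qed.

(** The sum of [window_bound] over all windows: cells of the centre weigh
2 * 4 and those on the sides 8, and the vees cancel. *)
Lemma kdependent3_card (m n : nat) (S : {set torus m n}) :
  kdependent 3 S -> (2 * #|S| <= #|{: torus m n}|)%N.
Proof.
move=> Sdep; rewrite -(@leq_pmul2l 8) //.
pose w (v : torus m n) c := king_move v c \in S.
have : (\sum_v (2 * count (w v) center + count (w v) sides
                + count (all (w v)) outward_vees)
        <= \sum_v (8 + count (all (w v)) inward_vees))%N.
  by apply: leq_sum => v _; apply/window_ineq/kdependent_center.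
rewrite [leqRHS]big_split [leqLHS]big_split [X in (X + _ <= _)%N]big_split -big_distrr.
rewrite !sum_count !sum_count_all inward_outward_vees leq_add2r sum_nat_const.
rewrite (eq_card (B := {: torus m n})) //=; lia.
Qed.

Lemma card_torus (m n : nat) : (2 <= m)%N -> (2 <= n)%N ->
  #|{: torus m n}| = (m * n)%N.
Proof. by move=> m2 n2; rewrite card_prod !card_ord !Zp_cast. Qed.

(** * Odd rows and the limit *)

Definition odd_rows (m n : nat) : {set torus m n} :=
  [set v : torus m n | odd v.1].

(** Reduction modulo [m] sends the successor of the last residue to 0, which is
even: no two odd residues are cyclically adjacent, even when [m] is odd. *)
Lemma odd_Zp_succ (m : nat) (x : 'Z_m) : odd x -> ~~ odd (x + 1)%R.
Proof.
rewrite /= (modn_small (isT : 1 < (Zp_trunc m).+2)%N) addn1 => ox.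
have := ltn_ord x; rewrite leq_eqVlt => /orP[/eqP-> | ltxm].
  by rewrite modnn.
by rewrite modn_small //= negbK.
Qed.

(** A step that changes the row leaves [odd_rows], so that each vertex keeps
only the two neighbors in its own row. *)
Lemma odd_rows_dependent (m n : nat) : kdependent 3 (odd_rows m n).
Proof.
apply/forall_inP => -[a b]; rewrite inE /= => oa.
have Na : ~~ odd (a + 1)%R by exact: odd_Zp_succ.
have Pa : ~~ odd (a - 1)%R.
  by apply: contraL oa => /odd_Zp_succ; rewrite subrK.
rewrite /nb_neighbors.
rewrite (@eq_in_count _ _ (predI (fun y => y.1 == 0)
           (fun y => king_move (a, b) y \in odd_rows m n))).
  have le2 : (count (fun y : int * int => y.1 == 0%R) king_steps <= 3)%N by [].
  by apply: leq_trans le2; apply: sub_count => y /andP[].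
move=> y; rewrite mem_filter => /andP[_ /allpairsP[[i j] [/= iin _ ->]]].
rewrite !inE /king_move /=; move: iin; rewrite !inE => /or3P[] /eqP -> //=.
  exact/negbTE.
exact/negbTE.
Qed.

Lemma card_odd_ord (n : nat) : #|[pred i : 'I_n | odd i]| = n./2.
Proof.
rewrite -sum1_card big_mkcond /=.
under eq_bigr => i _ do rewrite -[X in if X then _ else _]/(odd i).
elim: n => [|n IHn]; first by rewrite big_ord0.
by rewrite big_ord_recr /= IHn uphalf_half addnC; case: (odd n).
Qed.

Lemma card_odd_rows (m n : nat) : (2 <= m)%N -> (2 <= n)%N ->
  #|odd_rows m n| = (m./2 * n)%N.
Proof.
move=> m2 n2.
have -> : odd_rows m n = finset.setX [set a : 'Z_m | odd a] [set: 'Z_n].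
  by apply/finset.setP => -[a b]; rewrite !inE andbT.
by rewrite cardsX cardsE card_odd_ord cardsT card_ord !Zp_cast.
Qed.

Lemma beta_ge (n : nat) : (2 <= n)%N -> (n./2 * n <= beta 3 n n)%N.
Proof.
move=> n2; rewrite -card_odd_rows //.
exact: leq_bigmax_cond (odd_rows_dependent n n).
Qed.

Lemma beta_le (n : nat) : (2 <= n)%N -> (2 * beta 3 n n <= n * n)%N.
Proof.
move=> n2; rewrite /beta mul2n -geq_half_double.
apply/bigmax_leqP => S /kdependent3_card.
by rewrite card_torus // mul2n -geq_half_double.
Qed.

(** The floor in [n./2] costs at most [1 / (2 * n)], which [harmonic n], that is
[1 / (n + 1)], bounds for positive [n]. *)
Lemma beta_density_cvg (R : realType) :
  (beta_density R 3 @ \oo --> (1 / 2 : R))%classic.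
Proof.
apply: (@squeeze_cvgr _ _ _ _ (fun n => 1 / 2 - harmonic n) (fun=> 1 / 2)).
- exists 2%N => // n /= n2; rewrite /beta_density /harmonic.
  have n0 : 0 < n%:R :> R by rewrite ltr0n; lia.
  have n1 : 0 < n.+1%:R :> R by rewrite ltr0n.
  apply/andP; split.
    rewrite ler_pdivlMr ?exprn_gt0 //.
    have : (n./2 * n)%:R <= (beta 3 n n)%:R :> R by rewrite ler_nat beta_ge.
    apply: le_trans.
    have h : n%:R - 1 <= 2 * n./2%:R :> R.
      by rewrite lerBlDr -natrM natr1 ler_nat; lia.
    have i : n.+1%:R^-1 >= (2 * n%:R)^-1 :> R.
      by rewrite lef_pV2 ?posrE ?mulr_gt0 // -natrM ler_nat; lia.
    apply: (@le_trans _ _ ((1 / 2 - (2 * n%:R)^-1) * n%:R ^+ 2)).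
      by apply: ler_wpM2r; rewrite ?exprn_ge0 ?lerD2l ?lerN2.
    have -> : (1 / 2 - (2 * n%:R)^-1) * n%:R ^+ 2 = (n%:R - 1) / 2 * n%:R :> R.
      by field; rewrite gt_eqF.
    by rewrite natrM; apply: ler_wpM2r => //; lra.
  rewrite ler_pdivrMr ?exprn_gt0 // mulrAC ler_pdivlMr // mul1r.
  by rewrite -natrX -natrM ler_nat mulnC -mulnn; apply: beta_le.
- have := cvgB (cvg_cst (1 / 2 : R^o)) (@cvg_harmonic R).
  by rewrite subr0; apply.
- exact: cvg_cst.
Qed.

Theorem theorem6 (R : realType) :
  (forall (m n : nat) (S : {set torus m n}),
     (2 <= m)%N -> (2 <= n)%N -> kdependent 3 S ->
     #|S|%:R <= (m * n)%:R / 2 :> R)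
  /\ (cvgn (beta_density R 3) /\ tau2 R 3 = 1 / 2).
Proof.
split=> [m n S m2 n2 Sdep|].
  rewrite ler_pdivlMr // -natrM ler_nat mulnC -(card_torus m2 n2).
  exact: kdependent3_card.
have lim := @beta_density_cvg R.
by split; [apply/cvg_ex; exists (1 / 2) | exact: cvg_lim lim].
Qed.
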